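(* Let $A\in\mathbb{R}^{n\times n}$, $B_1\in\mathbb{R}^{n\times m_u}$, $B_2\in\mathbb{R}^{n\times m_d}$, $C_1\in\mathbb{R}^{p_y\times n}$, $C_2\in\mathbb{R}^{p_z\times n}$, $D_{11}\in\mathbb{R}^{p_y\times m_u}$, $D_{12}\in\mathbb{R}^{p_y\times m_d}$, $D_{21}\in\mathbb{R}^{p_z\times m_u}$, $D_{22}\in\mathbb{R}^{p_z\times m_d}$, and let $\varphi:\mathbb{R}^{p_y}\to\mathbb{R}^{m_u}$. Consider the open optimization algorithm $$x_{k+1}=Ax_k+B_1u_k+B_2d_k,\quad y_k=C_1x_k+D_{11}u_k+D_{12}d_k,\quad z_k=C_2x_k+D_{21}u_k+D_{22}d_k,\quad u_k=\varphi(y_k),\qquad k\in\mathbb{N},$$ with state $x_k$, external input $d_k$ and external output $z_k$. Let $S_\varphi=S_\varphi^\top\in\mathbb{R}^{(p_y+m_u)\times(p_y+m_u)}$ and assume that the oracle $\varphi$ satisfies, for all $y^1,y^2\in\mathbb{R}^{p_y}$, with $\Delta y=y^1-y^2$ and $\Delta u=\varphi(y^1)-\varphi(y^2)$, $$\begin{pmatrix}\Delta y\\ \Delta u\end{pmatrix}^\top S_\varphi\begin{pmatrix}\Delta y\\ \Delta u\end{pmatrix}\leq 0 .$$ Suppose that there are $P=P^\top\succ 0$ in $\mathbb{R}^{n\times n}$ and scalars $0<\gamma<1$, $\lambda>0$, $\mu>0$ such that $$\begin{bmatrix} I & A^\top\\ 0& B_1^\top\\ 0& B_2^\top\end{bmatrix}\begin{bmatrix}\gamma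 P&0\\0&-P\end{bmatrix}\begin{bmatrix} I & A^\top\\ 0& B_1^\top\\ 0& B_2^\top\end{bmatrix}^\top+\begin{bmatrix}C_1&D_{11}&D_{12}\\0&I&0\\C_2&D_{21}&D_{22}\\0&0&I\end{bmatrix}^\top\begin{bmatrix}\lambda S_\varphi&0&0\\0&-I&0\\0&0&\mu^2I\end{bmatrix}\begin{bmatrix}C_1&D_{11}&D_{12}\\0&I&0\\C_2&D_{21}&D_{22}\\0&0&I\end{bmatrix}\succeq 0 ,$$ and let $V(\Delta x)=(\Delta x)^\top P\,\Delta x$. Then: 1. The algorithm has incremental $\ell^2$ gain less than $\mu$. 2. If $d_k=0$ for all $k$, the algorithm is exponentially contractive with rate $\gamma$, towards a fixed point $x^\star$ with output $z^\star$. 3. Let $(z_k)_{k\in\mathbb{N}}$ denote an output trajectory of the algorithm initialized at $x_0$ and corresponding to the input signal $(d_k)_{k\in\mathbb{N}}$. Then for any sequence $(d_k)_{k\in\mathbb{N}}$ for which $\sum_{k=0}^\infty\|d_k\|_2$ is finite, $$\sum_{k=0}^\infty\|z^\star-z_k\|_2^2\leq V(x^\star-x_0)+\mu^2\sum_{k=0}^\infty\|d_k\|_2^2 .$$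
   Context: For two trajectories (superscripts 1 and 2) of the same system, increments are written $\Delta x_k=x_k^1-x_k^2$, and similarly $\Delta d_k,\Delta z_k$, etc. The two trajectories may have different initial states and different external inputs. Incremental $\ell^2$ gain less than $\mu$: by definition, the system is incrementally dissipative with respect to the supply rate $s_\ell(\Delta z,\Delta d)=-\|\Delta z\|_2^2+\mu^2\|\Delta d\|_2^2$, i.e. there exists a nonnegative function $W:\mathbb{R}^n\to\mathbb{R}$ (storage function) such that $W(\Delta x_{k+1})-W(\Delta x_k)\leq s_\ell(\Delta z_k,\Delta d_k)$ for all $k$ and all pairs of trajectories. Exponentially contractive with rate $\gamma\in(0,1)$: there is a quadratic function $W(\Delta x)=(\Delta x)^\top Q\,\Delta x$ with $Q\succ0$ such that $W(\Delta x_{k+1})-\gamma W(\Delta x_k)\leq 0$ for all $k\geq 0$ and all pairs of trajectories (here, trajectories with $d_k=0$). ''Towards a fixed point $x^\star$ with output $z^\star$'' means that there is a stationary state $x^\star$ of the algorithm with $d_k=0$, with $z^\star$ its (constant) output, and that all trajectories with $d_k=0$ converge to $x^\star$. In the matrix inequality, the block rows of the last factor correspond to $y$ (oracle output), $u$ (oracle input), $z$, $d$, in this order, and its block columns to $x,u,d$. The matrix $S_\varphi$ acts on $(y,u)$.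
   Formalization: In item 2, existence of the fixed point (and convergence to it) is stated assuming that y = C_1 x + D_11 φ(y) has a solution y for every x; otherwise no stationary state need exist, e.g. C_1=0, D_11=1, φ(y)=y+1, S_φ=0, B_1=0. *)

(* Defs.v *)
From mathcomp Require Import all_boot all_order all_algebra.
From mathcomp Require Import all_classical all_reals all_analysis.

Set Implicit Arguments.
Unset Strict Implicit.
Unset Printing Implicit Defensive.

Import Order.TTheory GRing.Theory Num.Theory.
Import numFieldNormedType.Exports.

Local Open Scope classical_set_scope.
Local Open Scope ring_scope.

(* The norm that MathComp-Analysis puts on matrices is the sup norm, so the
   Euclidean norm is defined here. The topology is the same. *)
Definition norm2 (R : realType) (n : nat) (v : 'cV[R]_n) : R :=
  Num.sqrt (\sum_(i < n) v i 0 ^+ 2).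

Definition quad (R : realType) (n : nat) (M : 'M[R]_n) (v : 'cV[R]_n) : R :=
  (v^T *m M *m v) 0 0.

Definition psdmx (R : realType) (n : nat) (M : 'M[R]_n) : Prop :=
  M^T = M /\ forall v : 'cV[R]_n, 0 <= quad M v.

Definition pdmx (R : realType) (n : nat) (M : 'M[R]_n) : Prop :=
  M^T = M /\ forall v : 'cV[R]_n, v != 0 -> 0 < quad M v.

Record open_algorithm (R : realType) (n mU mD pY pZ : nat) := OpenAlgorithm {
  algA : 'M[R]_(n, n);
  algB1 : 'M[R]_(n, mU);
  algB2 : 'M[R]_(n, mD);
  algC1 : 'M[R]_(pY, n);
  algC2 : 'M[R]_(pZ, n);
  algD11 : 'M[R]_(pY, mU);
  algD12 : 'M[R]_(pY, mD);
  algD21 : 'M[R]_(pZ, mU);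
  algD22 : 'M[R]_(pZ, mD);
  oracle : 'cV[R]_pY -> 'cV[R]_mU
}.

Section OpenAlgorithm.
Variables (R : realType) (n mU mD pY pZ : nat).
Variable alg : open_algorithm R n mU mD pY pZ.

Local Notation A := (algA alg).
Local Notation B1 := (algB1 alg).
Local Notation B2 := (algB2 alg).
Local Notation C1 := (algC1 alg).
Local Notation C2 := (algC2 alg).
Local Notation D11 := (algD11 alg).
Local Notation D12 := (algD12 alg).
Local Notation D21 := (algD21 alg).
Local Notation D22 := (algD22 alg).
Local Notation phi := (oracle alg).

Definition trajectory
    (d : nat -> 'cV[R]_mD) (x : nat -> 'cV[R]_n) (z : nat -> 'cV[R]_pZ) : Prop :=
  exists (y : nat -> 'cV[R]_pY) (u : nat -> 'cV[R]_mU), forall k : nat,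
    [/\ x k.+1 = A *m x k + B1 *m u k + B2 *m d k,
        y k = C1 *m x k + D11 *m u k + D12 *m d k,
        z k = C2 *m x k + D21 *m u k + D22 *m d k
      & u k = phi (y k)].

(* When D11 != 0 the oracle input and output solve an implicit equation. This
   says that the algorithm without external input can be run from every state;
   uniqueness of the solution is not required. It is automatic if D11 = 0. *)
Definition runnable : Prop :=
  forall x : 'cV[R]_n, exists y : 'cV[R]_pY, y = C1 *m x + D11 *m phi y.

Definition incrementally_dissipative
    (s : 'cV[R]_pZ -> 'cV[R]_mD -> R) : Prop :=
  exists W : 'cV[R]_n -> R, (forall v, 0 <= W v) /\
    forall d1 x1 z1 d2 x2 z2,
      trajectory d1 x1 z1 -> trajectory d2 x2 z2 ->
      forall k : nat,
        W (x1 k.+1 - x2 k.+1) - W (x1 k - x2 k)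
          <= s (z1 k - z2 k) (d1 k - d2 k).

Definition incremental_l2_gain_lt (mu : R) : Prop :=
  incrementally_dissipative
    (fun dz dd => - norm2 dz ^+ 2 + mu ^+ 2 * norm2 dd ^+ 2).

Definition exponentially_contractive (gamma : R) : Prop :=
  exists Q : 'M[R]_n, pdmx Q /\
    forall x1 z1 x2 z2,
      trajectory (fun=> 0) x1 z1 -> trajectory (fun=> 0) x2 z2 ->
      forall k : nat,
        quad Q (x1 k.+1 - x2 k.+1) - gamma * quad Q (x1 k - x2 k) <= 0.

Definition converges_to_fixed_point
    (xs : 'cV[R]_n) (zs : 'cV[R]_pZ) : Prop :=
  trajectory (fun=> 0) (fun=> xs) (fun=> zs) /\
  forall x z, trajectory (fun=> 0) x z -> x k @[k --> \oo] --> xs.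

Definition oracle_constraint (S : 'M[R]_(pY + mU)) : Prop :=
  forall y1 y2 : 'cV[R]_pY,
    quad S (col_mx (y1 - y2) (phi y1 - phi y2)) <= 0.

Definition lmi_state : 'M[R]_(n + (mU + mD), n + n) :=
  col_mx (row_mx 1%:M A^T)
         (col_mx (row_mx 0 B1^T)
                 (row_mx 0 B2^T)).

(* Row blocks y, u, z, d (grouped in pairs); column blocks x, u, d. *)
Definition lmi_signals : 'M[R]_((pY + mU) + (pZ + mD), n + (mU + mD)) :=
  col_mx (col_mx (row_mx C1 (row_mx D11 D12))
                 (row_mx 0 (row_mx 1%:M 0)))
         (col_mx (row_mx C2 (row_mx D21 D22))
                 (row_mx 0 (row_mx 0 1%:M))).

Definition lmi (S : 'M[R]_(pY + mU)) (P : 'M[R]_n) (gamma lambda mu : R) :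
    'M[R]_(n + (mU + mD)) :=
  lmi_state *m block_mx (gamma *: P) 0 0 (- P) *m lmi_state^T
  + lmi_signals^T
      *m block_mx (lambda *: S) 0
                  0 (block_mx (- 1%:M) 0 0 (mu ^+ 2)%:M)
      *m lmi_signals.

End OpenAlgorithm.

(* Main.v *)
From HB Require Import structures.
Require Import Defs.
From mathcomp Require Import all_boot all_order all_algebra.
From mathcomp Require Import all_classical all_reals all_analysis.
From mathcomp Require Import ring lra.

Import Order.TTheory GRing.Theory Num.Theory.
Import numFieldNormedType.Exports.

Local Open Scope classical_set_scope.
Local Open Scope ring_scope.

(** Evaluated at [(dx, du, dd)], the difference of two trajectories at one time
    step, the matrix inequality and the oracle constraint give
      [V(dx+) + |dz|^2 <= gamma V(dx) + mu^2 |dd|^2].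
    This is the dissipation inequality because [gamma <= 1], and contraction for
    [dd = 0]. A fixed point exists because the step map is a contraction for [V],
    which is equivalent to the squared norm. Telescoping the inequality along the
    fixed point and a given trajectory bounds the output deviation. *)

(* Lets Banach's fixed point theorem apply to column vectors. *)
HB.instance Definition _ (R : realType) (m n : nat) :=
  Complete.on 'M[R]_(m, n).

(** * Quadratic forms, and the equivalence of a definite one with the squared sup norm *)

Section QuadraticForms.
Set Implicit Arguments.
Unset Strict Implicit.
Context {R : realType}.

Lemma quad_mulmx (m n : nat) (M : 'M[R]_m) (N : 'M[R]_(m, n)) (v : 'cV[R]_n) :
  quad M (N *m v) = quad (N^T *m M *m N) v.
Proof. by rewrite /quad trmx_mul !mulmxA. Qed.

Lemma quadDl (n : nat) (M N : 'M[R]_n) (v : 'cV[R]_n) :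
  quad (M + N) v = quad M v + quad N v.
Proof. by rewrite /quad mulmxDr mulmxDl mxE. Qed.

Lemma quadZl (n : nat) (a : R) (M : 'M[R]_n) (v : 'cV[R]_n) :
  quad (a *: M) v = a * quad M v.
Proof. by rewrite /quad -scalemxAr -scalemxAl mxE. Qed.

Lemma quadNl (n : nat) (M : 'M[R]_n) (v : 'cV[R]_n) : quad (- M) v = - quad M v.
Proof. by rewrite -scaleN1r quadZl mulN1r. Qed.

Lemma quad_block_diag (m n : nat) (M : 'M[R]_m) (N : 'M[R]_n)
    (v : 'cV[R]_m) (w : 'cV[R]_n) :
  quad (block_mx M 0 0 N) (col_mx v w) = quad M v + quad N w.
Proof.
rewrite /quad tr_col_mx -mulmxA mul_block_col !mul0mx addr0 add0r.
by rewrite mul_row_col mxE !mulmxA.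
Qed.

Lemma quad1 (n : nat) (v : 'cV[R]_n) : quad 1%:M v = norm2 v ^+ 2.
Proof.
rewrite /quad mulmx1 mxE /norm2 sqr_sqrtr; last first.
  by apply: sumr_ge0 => i _; exact: sqr_ge0.
by apply: eq_bigr => i _; rewrite mxE expr2.
Qed.

Lemma quad_scalar (n : nat) (a : R) (v : 'cV[R]_n) :
  quad a%:M v = a * norm2 v ^+ 2.
Proof. by rewrite -scalemx1 quadZl quad1. Qed.

Lemma norm2N (n : nat) (v : 'cV[R]_n) : norm2 (- v) = norm2 v.
Proof. by congr Num.sqrt; apply: eq_bigr => i _; rewrite mxE sqrrN. Qed.

Lemma quad_comb (n : nat) (P : 'M[R]_n) (a b : R) (v w : 'cV[R]_n) :
  P^T = P ->
  quad P (a *: v + b *: w) =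
  a ^+ 2 * quad P v + 2 * a * b * (v^T *m P *m w) 0 0 + b ^+ 2 * quad P w.
Proof.
move=> Psym.
have vw : (w^T *m P *m v) 0 0 = (v^T *m P *m w) 0 0.
  have -> : w^T *m P *m v = (v^T *m P *m w)^T by rewrite !trmx_mul trmxK Psym mulmxA.
  by rewrite mxE.
rewrite /quad [(_ + _)^T]linearD /= [(a *: _)^T]linearZ /= [(b *: _)^T]linearZ /= !mulmxDl !mulmxDr.
rewrite -!(scalemxAl, scalemxAr).
move: (v^T *m P *m v) (v^T *m P *m w) (w^T *m P *m v) (w^T *m P *m w) vw.
by move=> X Y Z W ZY; rewrite !mxE ZY; ring.
Qed.

Lemma pdmx_quad_ge0 (n : nat) (P : 'M[R]_n) (v : 'cV[R]_n) :
  pdmx P -> 0 <= quad P v.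
Proof.
move=> [_ Ppos]; have [->|/Ppos/ltW//] := eqVneq v 0.
by rewrite /quad mulmx0 mxE.
Qed.

(** A nonzero row [r] with [r *m P = 0] would give a nonzero vector on which the form vanishes. *)
Lemma pdmx_unit (n : nat) (P : 'M[R]_n) : pdmx P -> P \in unitmx.
Proof.
move=> [Psym Ppos]; rewrite -row_free_unit -kermx_eq0; apply/eqP/row_matrixP => i.
rewrite row0; apply/eqP/negPn/negP => ker_neq0.
have /Ppos : (row i (kermx P))^T != 0 by rewrite -trmx0 (inj_eq trmx_inj).
by rewrite /quad trmxK -row_mul mulmx_ker row0 mul0mx mxE ltxx.
Qed.

(* The constant is the diagonal entry [(P^-1)_ii]: with [P w = e_i], the claim is
   the Cauchy-Schwarz inequality of the form [P] applied to [v] and [w]. *)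
Lemma pdmx_coord_bound (n : nat) (P : 'M[R]_n) (i : 'I_n) : pdmx P ->
  exists2 c : R, 0 <= c & forall v : 'cV[R]_n, v i 0 ^+ 2 <= c * quad P v.
Proof.
move=> Ppd; have Punit := pdmx_unit Ppd.
pose w : 'cV[R]_n := invmx P *m delta_mx i 0.
have Pw : P *m w = delta_mx i 0 by rewrite mulmxA mulmxV // mul1mx.
have vPw (v : 'cV[R]_n) : (v^T *m P *m w) 0 0 = v i 0.
  by rewrite -mulmxA Pw -colE !mxE.
have w_neq0 : w != 0.
  apply/eqP => w0; move/matrixP: Pw => /(_ i 0) /eqP.
  by rewrite w0 mulmx0 !mxE !eqxx eq_sym oner_eq0.
have c_gt0 := Ppd.2 _ w_neq0.
exists (quad P w); first exact: ltW.
(* With [c = quad P w], [a = v i 0] and [q = quad P v], the form at this vector is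
   [c * (c * q - a ^+ 2)]; the factor [c > 0] cancels. *)
move=> v; have := pdmx_quad_ge0 (quad P w *: v + - v i 0 *: w) Ppd.
rewrite quad_comb ?Ppd.1 // vPw.
set c := quad P w in c_gt0 *; set a := v i 0; set q := quad P v => h.
rewrite -(ler_pM2l c_gt0); nra.
Qed.

Lemma le_coord_mx_norm (m n : nat) (v : 'M[R]_(m, n)) i j : `|v i j| <= `|v|.
Proof.
rewrite [leRHS]/Num.Def.normr /= mx_normrE.
by apply/bigmax_geP; right; exists (i, j).
Qed.

(** A nonzero sup norm is attained at some coordinate, and the sum of the coordinate constants
    dominates each of them. *)
Lemma pdmx_norm_bound (n : nat) (P : 'M[R]_n) : pdmx P ->
  exists2 C : R, 0 <= C & forall v : 'cV[R]_n, `|v| ^+ 2 <= C * quad P v.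
Proof.
move=> Ppd; have /choice[c cP] : forall i : 'I_n, exists c : R,
    0 <= c /\ forall v : 'cV[R]_n, v i 0 ^+ 2 <= c * quad P v.
  by move=> i; have [c c0 cv] := pdmx_coord_bound i Ppd; exists c.
have c_ge0 i : 0 <= c i by case: (cP i).
exists (\sum_i c i) => [|v]; first exact: sumr_ge0.
have [v0|] := eqVneq (mx_norm v) 0.
  rewrite /Num.Def.normr /= v0 expr0n mulr_ge0 ?sumr_ge0 //.
  exact: pdmx_quad_ge0.
move=> /mx_norm_neq0[[i j] /= vij].
rewrite /Num.Def.normr /= vij (ord1 j) real_normK ?num_real //.
apply: le_trans ((cP i).2 v) _; rewrite ler_wpM2r ?pdmx_quad_ge0 //.
by rewrite (bigD1 i) //= lerDl sumr_ge0.
Qed.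

Lemma quad_norm_bound (n : nat) (P : 'M[R]_n) :
  exists2 K : R, 0 <= K & forall v : 'cV[R]_n, quad P v <= K * `|v| ^+ 2.
Proof.
exists (\sum_j \sum_i `|P i j|) => [|v].
  by do 2!apply: sumr_ge0 => ? _.
rewrite /quad mxE mulr_suml ler_sum // => j _.
rewrite mxE !mulr_suml ler_sum // => i _; rewrite mxE.
apply: le_trans (ler_norm _) _; rewrite !normrM mulrAC mulrC ler_wpM2l //.
by rewrite expr2 ler_pM // le_coord_mx_norm.
Qed.

(* [V] is equivalent to the squared norm, so some iterate of [F] contracts the
   norm by 1/2; its unique fixed point is also fixed by [F]. *)
Lemma quad_contraction_fixpoint (n : nat) (P : 'M[R]_n) (gamma : R)
    (F : 'cV[R]_n -> 'cV[R]_n) :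
  pdmx P -> 0 <= gamma < 1 ->
  (forall x y, quad P (F x - F y) <= gamma * quad P (x - y)) ->
  exists p, F p = p.
Proof.
move=> Ppd /andP[g0 g1] Fcontr.
have [C C0 CP] := pdmx_norm_bound Ppd.
have [K K0 KP] := quad_norm_bound P.
have iterF k x y : quad P (iter k F x - iter k F y) <= gamma ^+ k * quad P (x - y).
  elim: k => [|k IH] /=; first by rewrite mul1r.
  by apply: le_trans (Fcontr _ _) _; rewrite exprS -mulrA ler_wpM2l.
(* Through [CP], [iterF] and [KP], this factor bounds the squared norm of a difference of [N]-th
   iterates, so the target is the square of 1/2. *)
have [N CKN] : exists N, C * K * gamma ^+ N <= 2^-1 ^+ 2.
  have /cvgr0Pnorm_le/(_ (2^-1 ^+ 2)) : geometric (C * K) gamma @ \oo --> 0.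
    by apply: cvg_geometric; rewrite ger0_norm.
  rewrite exprn_gt0 ?invr_gt0 // => /(_ isT)[N _ /(_ N (leqnn N)) hN].
  by exists N; apply: le_trans hN; exact: ler_norm.
pose G : {fun [set: 'cV[R]_n] >-> [set: 'cV[R]_n]} := totalfun (iter N F).
have GE : G = iter N F :> (_ -> _) by [].
have Gcontr : is_contraction G.
  exists (2^-1)%:nng; split; first by rewrite /=; lra.
  move=> [x y] _ /=.
  rewrite -(@ler_pXn2r _ 2) ?nnegrE ?mulr_ge0 // GE exprMn.
  apply: le_trans (CP _) _.
  apply: le_trans (ler_wpM2l C0 (iterF _ _ _)) _.
  rewrite mulrA; apply: le_trans (ler_wpM2l _ (KP _)) _.
    by rewrite mulr_ge0 ?exprn_ge0.
  by rewrite mulrA ler_wpM2r ?sqr_ge0 // mulrAC.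
have [p _ Gp] := banach_fixed_point Gcontr closedT (ex_intro _ 0 I).
(* [F] commutes with its iterates, so [F p] is a fixed point of [G] as well. *)
exists p; apply: (contraction_fixpoint_unique Gcontr) => //.
by rewrite GE -iterSr iterS -GE -Gp.
Qed.

End QuadraticForms.

(** * The matrix inequality along pairs of trajectories *)

Section Trajectories.
Set Implicit Arguments.
Unset Strict Implicit.
Context {R : realType} {n mU mD pY pZ : nat}.
Variable alg : open_algorithm R n mU mD pY pZ.

(** The outer factors send the stacked vector to the state with its successor and to the signals
    [y], [u], [z], [d]; the middle factors are block diagonal, so the form splits. *)
Lemma quad_lmi (S : 'M[R]_(pY + mU)) (P : 'M[R]_n) (gamma lambda mu : R)
    (x : 'cV[R]_n) (u : 'cV[R]_mU) (d : 'cV[R]_mD) :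
  quad (lmi alg S P gamma lambda mu) (col_mx x (col_mx u d)) =
  gamma * quad P x
  - quad P (algA alg *m x + algB1 alg *m u + algB2 alg *m d)
  + (lambda * quad S (col_mx (algC1 alg *m x + algD11 alg *m u + algD12 alg *m d) u)
     - norm2 (algC2 alg *m x + algD21 alg *m u + algD22 alg *m d) ^+ 2
     + mu ^+ 2 * norm2 d ^+ 2).
Proof.
have Estate : (lmi_state alg)^T *m col_mx x (col_mx u d) =
    col_mx x (algA alg *m x + algB1 alg *m u + algB2 alg *m d).
  rewrite /lmi_state !tr_col_mx !tr_row_mx !trmxK !trmx0 trmx1.
  by rewrite !mul_row_col !mul_col_mx !add_col_mx mul1mx !mul0mx !addr0 addrA.
have Esignals : lmi_signals alg *m col_mx x (col_mx u d) =
    col_mx (col_mx (algC1 alg *m x + algD11 alg *m u + algD12 alg *m d) u)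
           (col_mx (algC2 alg *m x + algD21 alg *m u + algD22 alg *m d) d).
  rewrite /lmi_signals !mul_col_mx !mul_row_col !mul0mx !mul1mx.
  by rewrite !addrA !add0r !addr0.
rewrite /lmi quadDl -{1}[lmi_state alg]trmxK -!quad_mulmx Estate Esignals.
by rewrite !quad_block_diag !quadZl !quadNl quad1 quad_scalar; ring.
Qed.

Section Dissipation.
Context {S : 'M[R]_(pY + mU)} {P : 'M[R]_n} {gamma lambda mu : R}.
Hypothesis oracleS : oracle_constraint alg S.
Hypothesis lambda_gt0 : 0 < lambda.
Hypothesis lmi_psd : psdmx (lmi alg S P gamma lambda mu).

Lemma trajectory_dissipation d1 x1 z1 d2 x2 z2 k :
  trajectory alg d1 x1 z1 -> trajectory alg d2 x2 z2 ->
  quad P (x1 k.+1 - x2 k.+1) + norm2 (z1 k - z2 k) ^+ 2 <=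
  gamma * quad P (x1 k - x2 k) + mu ^+ 2 * norm2 (d1 k - d2 k) ^+ 2.
Proof.
move=> [y1 [u1 /(_ k)[-> y1E -> u1E]]] [y2 [u2 /(_ k)[-> y2E -> u2E]]].
(* Increments obey the same linear equations as the signals; only the oracle is nonlinear. *)
have subE m (M : 'M[R]_(m, n)) (N : 'M[R]_(m, mU)) (L : 'M[R]_(m, mD)) :
    M *m x1 k + N *m u1 k + L *m d1 k - (M *m x2 k + N *m u2 k + L *m d2 k) =
    M *m (x1 k - x2 k) + N *m (u1 k - u2 k) + L *m (d1 k - d2 k).
  by rewrite !mulmxBr !opprD addrACA; congr (_ + _); exact: addrACA.
have := lmi_psd.2 (col_mx (x1 k - x2 k) (col_mx (u1 k - u2 k) (d1 k - d2 k))).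
rewrite quad_lmi -!subE -y1E -y2E.
have := oracleS (y1 k) (y2 k); rewrite -u1E -u2E.
rewrite -(pmulr_rle0 _ lambda_gt0); lra.
Qed.

Lemma trajectory_contraction x1 z1 x2 z2 k :
  trajectory alg (fun=> 0) x1 z1 -> trajectory alg (fun=> 0) x2 z2 ->
  quad P (x1 k.+1 - x2 k.+1) <= gamma * quad P (x1 k - x2 k).
Proof.
move=> t1 t2; have := trajectory_dissipation k t1 t2.
rewrite subrr (_ : norm2 0 = 0) ?expr0n ?mulr0 ?addr0; last first.
  by rewrite /norm2 big1 ?sqrtr0 // => i _; rewrite mxE expr0n.
by apply: le_trans; rewrite lerDl sqr_ge0.
Qed.

Lemma trajectory_gain_sum d1 x1 z1 d2 x2 z2 m :
  pdmx P -> gamma <= 1 ->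
  trajectory alg d1 x1 z1 -> trajectory alg d2 x2 z2 ->
  \sum_(0 <= k < m) norm2 (z1 k - z2 k) ^+ 2 <=
  quad P (x1 0%N - x2 0%N) + mu ^+ 2 * \sum_(0 <= k < m) norm2 (d1 k - d2 k) ^+ 2.
Proof.
move=> Ppd g1 t1 t2.
(* Keeping the final storage term makes the bound inductive; being nonnegative, it is dropped
   afterwards. *)
suff : quad P (x1 m - x2 m) + \sum_(0 <= k < m) norm2 (z1 k - z2 k) ^+ 2 <=
    quad P (x1 0%N - x2 0%N) +
    mu ^+ 2 * \sum_(0 <= k < m) norm2 (d1 k - d2 k) ^+ 2.
  by apply: le_trans; rewrite lerDr pdmx_quad_ge0.
elim: m => [|m IH]; first by rewrite !big_geq // mulr0.
rewrite !big_nat_recr //= mulrDr.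
have := trajectory_dissipation m t1 t2.
have : gamma * quad P (x1 m - x2 m) <= quad P (x1 m - x2 m).
  by rewrite ler_piMl ?pdmx_quad_ge0.
lra.
Qed.

(** The form of the error decays geometrically and dominates the squared norm up to a constant. *)
Lemma trajectory_cvg xs zs x z : pdmx P -> 0 <= gamma < 1 ->
  trajectory alg (fun=> 0) (fun=> xs) (fun=> zs) ->
  trajectory alg (fun=> 0) x z -> x k @[k --> \oo] --> xs.
Proof.
move=> Ppd /andP[g0 g1] ts t; have [C C0 CP] := pdmx_norm_bound Ppd.
have Vgeo k : quad P (xs - x k) <= gamma ^+ k * quad P (xs - x 0%N).
  elim: k => [|k IH]; first by rewrite mul1r.
  apply: le_trans (trajectory_contraction k ts t) _.
  by rewrite exprS -mulrA ler_wpM2l.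
apply/cvgrPdist_lt => e e0.
have /cvgr0Pnorm_lt/(_ (e ^+ 2)) :
    geometric (C * quad P (xs - x 0%N)) gamma @ \oo --> 0.
  by apply: cvg_geometric; rewrite ger0_norm.
rewrite exprn_gt0 // => /(_ isT); apply: filterS => k hk.
rewrite -(@ltr_pXn2r _ 2) ?nnegrE ?(ltW e0) //.
apply: le_lt_trans (le_lt_trans (ler_norm _) hk) => /=.
apply: le_trans (CP _) _; rewrite -mulrA ler_wpM2l //.
by rewrite mulrC.
Qed.

End Dissipation.

(** Choosing one solution of the implicit equation for each state turns the algorithm without input
    into the iteration of a map. *)
Lemma runnable_iter : runnable alg ->
  exists (F : 'cV[R]_n -> 'cV[R]_n) (G : 'cV[R]_n -> 'cV[R]_pZ), forall a,
    trajectory alg (fun=> 0) (fun k => iter k F a) (fun k => G (iter k F a)).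
Proof.
move=> /choice[Y YE].
exists (fun x => algA alg *m x + algB1 alg *m oracle alg (Y x)).
exists (fun x => algC2 alg *m x + algD21 alg *m oracle alg (Y x)) => a.
set x := fun k => iter k _ a.
exists (fun k => Y (x k)), (fun k => oracle alg (Y (x k))) => k.
by rewrite !mulmx0 !addr0; split.
Qed.

End Trajectories.

Theorem theoremV2 (R : realType) (n mU mD pY pZ : nat)
    (alg : open_algorithm R n mU mD pY pZ)
    (S : 'M[R]_(pY + mU)) (P : 'M[R]_n) (gamma lambda mu : R)
    (S_sym : S^T = S)
    (oracleS : oracle_constraint alg S)
    (P_pd : pdmx P)
    (gamma_gt0 : 0 < gamma) (gamma_lt1 : gamma < 1)
    (lambda_gt0 : 0 < lambda) (mu_gt0 : 0 < mu)
    (lmi_psd : psdmx (lmi alg S P gamma lambda mu)) :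
  [/\ incremental_l2_gain_lt alg mu,
      exponentially_contractive alg gamma,
      runnable alg -> exists (xs : 'cV[R]_n) (zs : 'cV[R]_pZ),
        converges_to_fixed_point alg xs zs
    & forall (xs : 'cV[R]_n) (zs : 'cV[R]_pZ),
        converges_to_fixed_point alg xs zs ->
      forall (d : nat -> 'cV[R]_mD) (x : nat -> 'cV[R]_n)
             (z : nat -> 'cV[R]_pZ),
        trajectory alg d x z ->
        (\sum_(0 <= k <oo) (norm2 (d k))%:E < +oo)%E ->
        (\sum_(0 <= k <oo) (norm2 (zs - z k) ^+ 2)%:E
           <= (quad P (xs - x 0%N))%:E
              + (mu ^+ 2)%:E * \sum_(0 <= k <oo) (norm2 (d k) ^+ 2)%:E)%E].
Proof.
have g01 : 0 <= gamma < 1 by rewrite ltW.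
split.
- exists (quad P); split=> [v|d1 x1 z1 d2 x2 z2 t1 t2 k]; first exact: pdmx_quad_ge0.
  have := trajectory_dissipation oracleS lambda_gt0 lmi_psd k t1 t2.
  have : gamma * quad P (x1 k - x2 k) <= quad P (x1 k - x2 k).
    by rewrite ler_piMl ?pdmx_quad_ge0 ?ltW.
  lra.
- exists P; split=> // x1 z1 x2 z2 t1 t2 k; rewrite subr_le0.
  exact: (trajectory_contraction oracleS lambda_gt0 lmi_psd k t1 t2).
- move=> /runnable_iter[F [G traj]].
  have [p Fp] : exists p, F p = p.
    apply: (quad_contraction_fixpoint P_pd g01) => a b.
    (* At time 0, the iterations started at [a] and [b] move to [F a] and [F b]. *)
    exact: (trajectory_contraction oracleS lambda_gt0 lmi_psd 0 (traj a) (traj b)).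
  have tp : trajectory alg (fun=> 0) (fun=> p) (fun=> G p).
    have iterp : (fun k => iter k F p) = (fun=> p).
      by apply/funext => k; exact: iter_fix.
    have := traj p; rewrite iterp.
    by rewrite (_ : (fun k => G (iter k F p)) = fun=> G p) //; apply/funext => k; rewrite iter_fix.
  exists p, (G p); split=> // x z.
  exact: (trajectory_cvg oracleS lambda_gt0 lmi_psd P_pd g01 tp).
- move=> xs zs [ts _] d x z t _.
  rewrite -nneseriesZl => [|k _]; last by rewrite lee_fin sqr_ge0.
  (* It suffices to bound each partial sum on the left: the finite-horizon bound applies, and its
     input sum is at most the full series. *)
  apply: lime_le; first by apply: is_cvg_nneseries => k _ _; rewrite lee_fin sqr_ge0.
  apply: nearW => m.
  have := trajectory_gain_sum oracleS lambda_gt0 lmi_psd m P_pd (ltW gamma_lt1) ts t.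
  rewrite sumEFin -lee_fin => /le_trans; apply.
  rewrite EFinD leeD2l // mulr_sumr -sumEFin.
  (* The fixed point runs with zero input, so the input increment is [- d k]. *)
  under eq_bigr do rewrite sub0r norm2N EFinM.
  by apply: nneseries_lim_ge => k _ _; rewrite mule_ge0 ?lee_fin ?sqr_ge0.
Qed.
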